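(* The Grushin plane $\mathbb G$ equipped with its Carnot–Carathéodory distance $d_{cc}$ admits a bi-Lipschitz embedding into some Euclidean space $\mathbb R^n$.
   Context: The Grushin plane $\mathbb G$ is $\mathbb R^2$ with horizontal distribution spanned by $X_1=\partial_x$ and $X_2=x\,\partial_y$. A horizontal curve is an absolutely continuous $\gamma=(\mathrm x,\mathrm y):[0,1]\to\mathbb R^2$ with $\mathrm x'=a$, $\mathrm y'=\mathrm x\,b$ a.e. for measurable $a,b$; its length is $\int_0^1\sqrt{a^2+b^2}\,dt$. The Carnot–Carathéodory distance $d_{cc}(p,q)$ is the infimum of lengths of horizontal curves joining $p$ to $q$. *)

(* Defs.v *)
From Stdlib Require Import Reals Lra List.
Import ListNotations.
Open Scope R_scope.

Fixpoint psum (N : nat) (g : nat -> R) : R :=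
  match N with O => 0 | S k => psum k g + g k end.

(* A can be covered by countably many open intervals of total length <= eps
   (i.e. the Lebesgue outer measure of A is at most eps, up to a limit). *)
Definition small_outer (A : R -> Prop) (eps : R) : Prop :=
  exists a b : nat -> R,
    (forall k, a k <= b k) /\
    (forall x, A x -> exists k, a k < x < b k) /\
    (forall N, psum N (fun k => b k - a k) <= eps).

Definition null (A : R -> Prop) : Prop :=
  forall eps, 0 < eps -> small_outer A eps.

Definition ae01 (P : R -> Prop) : Prop :=
  null (fun t => 0 <= t <= 1 /\ ~ P t).

Definition meas_set (E : R -> Prop) : Prop :=
  forall eps, 0 < eps ->
    exists G : R -> Prop, open_set G /\ (forall x, E x -> G x) /\
      small_outer (fun x => G x /\ ~ E x) eps.

Definition meas01 (f : R -> R) : Prop :=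
  forall c, meas_set (fun t => 0 <= t <= 1 /\ c < f t).

Fixpoint ac_chain (s : R) (L : list (R * R)) : Prop :=
  match L with
  | [] => s <= 1
  | (a, b) :: L' => s <= a /\ a <= b /\ ac_chain b L'
  end.

Fixpoint chain_len (L : list (R * R)) : R :=
  match L with [] => 0 | (a, b) :: L' => (b - a) + chain_len L' end.

Fixpoint chain_var (f : R -> R) (L : list (R * R)) : R :=
  match L with [] => 0 | (a, b) :: L' => Rabs (f b - f a) + chain_var f L' end.

Definition abs_cont01 (f : R -> R) : Prop :=
  forall eps, 0 < eps -> exists delta, 0 < delta /\
    forall L, ac_chain 0 L -> chain_len L < delta -> chain_var f L < eps.

(* Gauge (Henstock-Kurzweil) integral; for nonnegative measurable functions
   it coincides with the Lebesgue integral (finite in one sense iff in the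
   other, with the same value). *)

(* tagged partition from s to e: list of (tag, right endpoint), delta-fine *)
Fixpoint fine (delta : R -> R) (s e : R) (P : list (R * R)) : Prop :=
  match P with
  | [] => s = e
  | (t, r) :: P' =>
      s < r /\ s <= t <= r /\ t - delta t < s /\ r < t + delta t /\
      fine delta r e P'
  end.

Fixpoint rsum (f : R -> R) (s : R) (P : list (R * R)) : R :=
  match P with
  | [] => 0
  | (t, r) :: P' => f t * (r - s) + rsum f r P'
  end.

Definition integral01 (f : R -> R) (v : R) : Prop :=
  forall eps, 0 < eps -> exists delta : R -> R, (forall t, 0 < delta t) /\
    forall P, fine delta 0 1 P -> Rabs (rsum f 0 P - v) < eps.

Definition grushin_horizontal (x y a b : R -> R) : Prop :=
  abs_cont01 x /\ abs_cont01 y /\ meas01 a /\ meas01 b /\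
  ae01 (fun t => derivable_pt_lim x t (a t) /\
                 derivable_pt_lim y t (x t * b t)).

Definition grushin_length_of_curve (p q : R * R) (l : R) : Prop :=
  exists x y a b : R -> R,
    grushin_horizontal x y a b /\
    (x 0, y 0) = p /\ (x 1, y 1) = q /\
    integral01 (fun t => sqrt (a t ^ 2 + b t ^ 2)) l.

Definition is_glb (S : R -> Prop) (m : R) : Prop :=
  (forall l, S l -> m <= l) /\
  (forall m', (forall l, S l -> m' <= l) -> m' <= m).

Definition is_dcc (p q : R * R) (d : R) : Prop :=
  is_glb (grushin_length_of_curve p q) d.

(* points of R^n are functions nat -> R, only indices < n matter *)
Definition eucl_dist (n : nat) (u v : nat -> R) : R :=
  sqrt (psum n (fun i => (u i - v i) ^ 2)).

(* Main.v *)
Require Import Defs.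
From Stdlib Require Import Reals Lra Lia List ZArith.
From Stdlib Require Import Classical ClassicalEpsilon FunctionalExtensionality.
From Coquelicot Require Import Coquelicot.
Import List ListNotations.
Open Scope R_scope.

(** A horizontal curve of length [l] from [(x0, y0)] to [(x1, y1)] satisfies
    [|x0 - x1| <= l] and, since its abscissa stays within [l] of [x0],
    [|y0 - y1| <= (|x0| + l) l].  Conversely, moving to the abscissa [x0] or
    [sqrt |y0 - y1|], whichever is larger in absolute value, then vertically, then to
    [(x1, y1)], gives a curve for which one of the two inequalities is sharp up
    to a constant.

    The embedding is an Assouad-type lacunary series: next to the coordinate
    [x], take the sums of [2^-k (e^(i 4^k y) - 1) / (1 + (2^k x)^2)] over [k] in
    a residue class modulo 20.  If [l] satisfies the two inequalities and
    [s = max(|x0|, l)], then the [k]-th term varies between the two points by at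
    most [8 l min(2^k s, 1 / (2^k s))]; summing gives the Lipschitz bound.  If
    the inequality for [y] is sharp and [x] varies little, then the term with
    [2^k s] close to 1 varies by a definite multiple of [l] and dominates the
    other terms of its residue class. *)

(** * Lower bounds on the length of a horizontal curve *)

Lemma fine_app (delta : R -> R) (P Q : list (R * R)) (s m e : R) :
  fine delta s m P -> fine delta m e Q -> fine delta s e (P ++ Q).
Proof.
revert s; induction P as [|[t r] P IH]; simpl; intros s HP HQ.
- now subst.
- intuition.
Qed.

Lemma rsum_app (delta f : R -> R) (P Q : list (R * R)) (s m : R) :
  fine delta s m P -> rsum f s (P ++ Q) = rsum f s P + rsum f m Q.
Proof.
revert s; induction P as [|[t r] P IH]; simpl; intros s HP.
- subst; ring.
- rewrite IH by intuition; ring.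
Qed.

Lemma fine_le (delta : R -> R) (P : list (R * R)) (s e : R) :
  fine delta s e P -> s <= e.
Proof.
revert s; induction P as [|[t r] P IH]; simpl; intros s HP.
- lra.
- assert (r <= e) by (apply IH; tauto). lra.
Qed.

Lemma fine_mono (delta delta' : R -> R) (P : list (R * R)) (s e : R) :
  (forall t, delta t <= delta' t) -> fine delta s e P -> fine delta' s e P.
Proof.
intros Hd; revert s; induction P as [|[t r] P IH]; simpl; intros s HP; trivial.
specialize (Hd t); destruct HP as (H1 & H2 & H3 & H4 & H5).
repeat split; try lra; auto.
Qed.

Lemma rsum_nonneg (delta f : R -> R) (P : list (R * R)) (s e : R) :
  (forall t, 0 <= f t) -> fine delta s e P -> 0 <= rsum f s P.
Proof.
intros Hf; revert s; induction P as [|[t r] P IH]; simpl; intros s HP.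
- lra.
- assert (0 <= rsum f r P) by (apply IH; tauto).
  assert (0 <= f t * (r - s)) by (apply Rmult_le_pos; [apply Hf | lra]). lra.
Qed.

(** Cousin's lemma. Let [c] be the supremum of the points reachable from [a]; one cell tagged at [c]
    starts at a reachable point close to [c] and passes beyond [c] unless it meets [b] first. *)
Lemma cousin (delta : R -> R) (a b : R) :
  (forall t, 0 < delta t) -> a <= b -> exists P, fine delta a b P.
Proof.
intros Hd Hab.
set (E := fun e => a <= e <= b /\ exists P, fine delta a e P).
assert (HE : E a) by (split; [lra | exists []; reflexivity]).
destruct (completeness E) as [c [Hub Hlub]].
- exists b; intros e [He _]; lra.
- now exists a.
- assert (Hac : a <= c) by now apply Hub.
  assert (Hcb : c <= b) by (apply Hlub; intros e [He _]; lra).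
  assert (Hc := Hd c).
  assert (exists e, E e /\ c - delta c < e) as [e [[He [P HP]] Hce]].
  { apply NNPP; intros Hn.
    assert (c <= c - delta c); [|lra].
    apply Hlub; intros e He; apply Rnot_lt_le; intros Hlt; apply Hn; eauto. }
  assert (Hec : e <= c) by (apply Hub; split; eauto).
  (* Half of [delta c] keeps the fineness inequality strict; the cap keeps [r] in the interval. *)
  set (r := Rmin b (c + delta c / 2)).
  assert (Hr : r <= b /\ r <= c + delta c / 2) by (split; [apply Rmin_l | apply Rmin_r]).
  assert (Hcr : c <= r) by (apply Rmin_glb; lra).
  destruct (Rle_lt_dec r e) as [Hre|Her].
  + assert (e = b) as ->; [|eauto].
    destruct (Rle_lt_dec b e); [lra|].
    assert (r = b \/ r = c + delta c / 2) by (unfold r, Rmin; destruct Rle_dec; auto).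
    lra.
  + assert (HrE : E r).
    { split; [lra|]. exists (P ++ [(c, r)]). apply fine_app with e; trivial.
      simpl; repeat split; lra. }
    assert (r <= c) by now apply Hub.
    assert (Hrb : r = b \/ r = c + delta c / 2) by (unfold r, Rmin; destruct Rle_dec; auto).
    assert (Heq : r = b) by lra.
    rewrite <- Heq; apply HrE.
Qed.

Lemma integral01_nonneg (h : R -> R) (l : R) :
  (forall t, 0 <= h t) -> integral01 h l -> 0 <= l.
Proof.
intros Hh Hl; apply Rnot_lt_le; intros Hneg.
destruct (Hl (- l)) as [delta [Hd HP]]; [lra|].
destruct (cousin delta 0 1 Hd) as [P Hfine]; [lra|].
specialize (HP P Hfine). assert (H0 := rsum_nonneg _ _ _ _ _ Hh Hfine).
apply Rabs_def2 in HP; lra.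
Qed.

Lemma ac_chain_mono (L : list (R * R)) (s s' : R) :
  s' <= s -> ac_chain s L -> ac_chain s' L.
Proof. destruct L as [|[a b] L]; simpl; intros Hs HL; repeat split; try tauto; lra. Qed.

Lemma chain_len_within (L : list (R * R)) (s b : R) :
  s <= b -> ac_chain s L -> Forall (fun I => snd I < b) L ->
  chain_len L <= b - s.
Proof.
revert s; induction L as [|[c d] L IH]; simpl; intros s Hs HL HF.
- lra.
- inversion HF; subst; simpl in *.
  assert (chain_len L <= b - d) by (apply IH; tauto || lra). lra.
Qed.

(** Chains may have gaps, so any subfamily of a chain is again a chain. *)
Lemma chain_split (A B : R * R -> Prop) (L : list (R * R)) (s : R) :
  ac_chain s L -> Forall (fun I => A I \/ B I) L ->
  exists L1 L2, ac_chain s L1 /\ ac_chain s L2 /\ Forall A L1 /\ Forall B L2 /\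
    chain_len L = chain_len L1 + chain_len L2.
Proof.
revert s; induction L as [|[c d] L IH]; simpl; intros s HL HF.
- exists [], []; simpl; repeat split; auto; ring.
- inversion HF as [|I L' HI HF']; subst.
  destruct HL as (H1 & H2 & HL).
  destruct (IH d HL HF') as (L1 & L2 & HL1 & HL2 & HA & HB & Hlen).
  destruct HI as [HI|HI].
  + exists ((c, d) :: L1), L2; simpl; repeat split; auto.
    * apply ac_chain_mono with d; auto; lra.
    * rewrite Hlen; ring.
  + exists L1, ((c, d) :: L2); simpl; repeat split; auto.
    * apply ac_chain_mono with d; auto; lra.
    * rewrite Hlen; ring.
Qed.

(** Finite subadditivity of length, by induction on the number of covering intervals: the members
    lying in the last one form a chain inside it, and the others are covered by the rest. *)
Lemma chain_len_cover (a b : nat -> R) (n : nat) (L : list (R * R)) (s : R) :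
  (forall k, a k <= b k) -> ac_chain s L ->
  Forall (fun I => exists k, (k < n)%nat /\ a k < fst I /\ snd I < b k) L ->
  chain_len L <= psum n (fun k => b k - a k).
Proof.
intros Hab; revert L s; induction n as [|n IH]; intros L s HL HF; simpl.
- destruct L as [|I L]; simpl; [lra|].
  inversion HF as [|? ? [k [Hk _]]]; lia.
- destruct (chain_split
    (fun I => exists k, (k < n)%nat /\ a k < fst I /\ snd I < b k)
    (fun I => a n < fst I /\ snd I < b n) L s) as (L1 & L2 & HL1 & HL2 & HF1 & HF2 & ->); trivial.
  { revert HF; apply Forall_impl; intros I [k [Hk HI]].
    destruct (Nat.eq_dec k n) as [->|Hne]; [now right|].
    left; exists k; split; [lia | exact HI]. }
  apply Rplus_le_compat; [eapply IH; eauto|].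
  destruct L2 as [|[c d] L2].
  { specialize (Hab n); simpl; lra. }
  apply chain_len_within; trivial.
  + destruct HL2 as (_ & Hcd & HL2). inversion HF2 as [|? ? [Hc _]]; simpl in *.
    repeat split; trivial; lra.
  + revert HF2; apply Forall_impl; tauto.
Qed.

Lemma finite_cover_index (a b : nat -> R) (L : list (R * R)) :
  Forall (fun I => exists k, a k < fst I /\ snd I < b k) L ->
  exists n, Forall (fun I => exists k, (k < n)%nat /\ a k < fst I /\ snd I < b k) L.
Proof.
induction 1 as [|I L [k Hk] _ [n Hn]]; [now exists O|].
exists (S (Nat.max k n)); constructor.
- exists k; split; [lia | exact Hk].
- revert Hn; apply Forall_impl; intros J [j [Hj HJ]].
  exists j; split; [lia | exact HJ].
Qed.

(** The straddle lemma: both ends are compared with the tag [t], and since [t] lies between them the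
    two errors add up to [eps * (r - s)]. *)
Lemma increment_of_derivative (f : R -> R) (t d eps : R) :
  derivable_pt_lim f t d -> 0 < eps ->
  exists delta, 0 < delta /\ forall s r, s <= t <= r -> t - delta < s -> r < t + delta ->
    Rabs (f r - f s - d * (r - s)) <= eps * (r - s).
Proof.
intros Hf Heps; destruct (Hf eps Heps) as [[delta Hdelta] Hlim]; simpl in Hlim.
exists delta; split; trivial; intros s r Hst Hs Hr.
assert (Hstep : forall u, Rabs (u - t) < delta ->
  Rabs (f u - f t - d * (u - t)) <= eps * Rabs (u - t)).
{ intros u Hu; destruct (Req_dec u t) as [->|Hne].
  - replace (f t - f t - d * (t - t)) with 0 by ring.
    rewrite Rminus_diag, Rabs_R0; lra.
  - specialize (Hlim (u - t)). replace (t + (u - t)) with u in Hlim by ring.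
    replace (f u - f t - d * (u - t)) with (((f u - f t) / (u - t) - d) * (u - t))
      by (field; lra).
    rewrite Rabs_mult; apply Rmult_le_compat_r; [apply Rabs_pos|].
    apply Rlt_le, Hlim; [lra | exact Hu]. }
assert (H1 := Hstep r); assert (H2 := Hstep s).
rewrite (Rabs_pos_eq (r - t)) in H1 by lra.
rewrite (Rabs_left1 (s - t)) in H2 by lra.
replace (f r - f s - d * (r - s))
  with ((f r - f t - d * (r - t)) - (f s - f t - d * (s - t))) by ring.
eapply Rle_trans; [apply Rabs_triang|]. rewrite Rabs_Ropp.
assert (H1' := H1 ltac:(lra)); assert (H2' := H2 ltac:(lra)). lra.
Qed.

(* The exceptional tags are swallowed by a cover of small total length, on
   which absolute continuity controls the variation of [f]. *)
Lemma ac_increment_le (f h : R -> R) (K l t0 : R) :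
  abs_cont01 f -> (forall t, 0 <= h t) -> 0 <= K ->
  ae01 (fun t => exists d, derivable_pt_lim f t d /\ Rabs d <= K * h t) ->
  integral01 h l -> 0 <= t0 <= 1 -> Rabs (f t0 - f 0) <= K * l.
Proof.
intros Hac Hh HK Hae Hint Ht0.
apply Rnot_lt_le; intros Hlt.
(* The errors below amount to less than [(K + 2) * eps]: [eps] for the variation on the cover,
   [K * eps] for the Riemann sum, [eps] for the derivatives. *)
set (eps := (Rabs (f t0 - f 0) - K * l) / (K + 3)).
assert (Heps : 0 < eps) by (apply Rdiv_lt_0_compat; lra).
assert (Hgap : Rabs (f t0 - f 0) = K * l + (K + 3) * eps) by (unfold eps; field; lra).
destruct (Hac eps Heps) as (eta & Heta & Hvar).
destruct (Hae (eta / 2)) as (a & b & Hab & Hcov & Hsum); [lra|].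
destruct (Hint eps Heps) as (d0 & Hd0 & Hrs).
(* A cell around an exceptional tag stays inside one covering interval; around any other tag the
   straddle lemma applies. *)
assert (Hloc : forall t, exists delta, 0 < delta /\
  (0 <= t <= 1 -> forall s r, s <= t <= r -> t - delta < s -> r < t + delta ->
    (exists k, a k < s /\ r < b k) \/
    Rabs (f r - f s) <= (K * h t + eps) * (r - s))).
{ intros t.
  destruct (classic (0 <= t <= 1)) as [Ht|Ht]; [|exists 1; split; [lra|tauto]].
  destruct (classic (exists d, derivable_pt_lim f t d /\ Rabs d <= K * h t))
    as [[d [Hd Hdk]]|Hbad].
  - destruct (increment_of_derivative f t d eps Hd Heps) as (delta & Hdelta & Hinc).
    exists delta; split; trivial; intros _ s r Hst Hs Hr; right.
    specialize (Hinc s r Hst Hs Hr).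
    replace (f r - f s) with ((f r - f s - d * (r - s)) + d * (r - s)) by ring.
    eapply Rle_trans; [apply Rabs_triang|].
    rewrite (Rabs_mult d), (Rabs_pos_eq (r - s)) by lra.
    assert (Rabs d * (r - s) <= K * h t * (r - s)) by (apply Rmult_le_compat_r; lra).
    lra.
  - destruct (Hcov t (conj Ht Hbad)) as [k Hk].
    exists (Rmin (t - a k) (b k - t)); split; [apply Rmin_glb_lt; lra|].
    intros _ s r Hst Hs Hr; left; exists k.
    assert (H1 := Rmin_l (t - a k) (b k - t)); assert (H2 := Rmin_r (t - a k) (b k - t)).
    lra. }
destruct (choice _ Hloc) as [d1 Hd1].
set (delta := fun t => Rmin (d0 t) (d1 t)).
assert (Hdelta : forall t, 0 < delta t).
{ intros t; apply Rmin_glb_lt; [apply Hd0 | apply Hd1]. }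
destruct (cousin delta 0 t0 Hdelta) as [P HP]; [lra|].
destruct (cousin delta t0 1 Hdelta) as [Q HQ]; [lra|].
assert (HPQ := Hrs (P ++ Q)). rewrite (rsum_app delta h P Q 0 t0 HP) in HPQ.
assert (HPQf : fine d0 0 1 (P ++ Q)).
{ apply fine_mono with delta; [intros t; apply Rmin_l|].
  now apply fine_app with t0. }
specialize (HPQ HPQf). apply Rabs_def2 in HPQ.
assert (HQ0 := rsum_nonneg delta h Q t0 1 Hh HQ).
(* The chain [L] collects the cells with exceptional tags; the other cells are charged to the
   Riemann sum. *)
assert (Hmain : forall W s, 0 <= s -> fine delta s t0 W -> exists L,
  ac_chain s L /\ Forall (fun I => exists k, a k < fst I /\ snd I < b k) L /\
  Rabs (f t0 - f s) <= chain_var f L + K * rsum h s W + eps * (t0 - s)).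
{ clear - Hd1 Hh HK Ht0 Heps.
  induction W as [|[t r] W IH]; simpl; intros s Hs HR.
  - subst; exists []; simpl; repeat split; [lra|constructor|].
    rewrite Rminus_diag, Rabs_R0; lra.
  - destruct HR as (H1 & H2 & H3 & H4 & HR).
    assert (Hrt := fine_le _ _ _ _ HR).
    destruct (IH r) as (L & HL & HF & Hb); [lra|trivial|].
    assert (Htri : Rabs (f t0 - f s) <= Rabs (f t0 - f r) + Rabs (f r - f s)).
    { replace (f t0 - f s) with ((f t0 - f r) + (f r - f s)) by ring. apply Rabs_triang. }
    assert (H5 : delta t <= d1 t) by apply Rmin_r.
    destruct (Hd1 t) as [_ Ht]. specialize (Ht ltac:(lra) s r H2 ltac:(lra) ltac:(lra)).
    assert (Hpos : 0 <= K * (h t * (r - s))).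
    { apply Rmult_le_pos; trivial. apply Rmult_le_pos; [apply Hh | lra]. }
    assert (Hpos' : 0 <= eps * (r - s)) by (apply Rmult_le_pos; lra).
    destruct Ht as [Hk|Hk].
    + exists ((s, r) :: L); simpl; repeat split; auto; try lra.
    + exists L; repeat split; trivial; [apply ac_chain_mono with r; trivial; lra|].
      lra. }
destruct (Hmain P 0 ltac:(lra) HP) as (L & HL & HF & Hb).
destruct (finite_cover_index a b L HF) as [n HFn].
assert (Hlen := chain_len_cover a b n L 0 Hab HL HFn).
specialize (Hsum n). specialize (Hvar L HL ltac:(lra)).
assert (K * rsum h 0 P <= K * (l + eps)) by (apply Rmult_le_compat_l; lra).
assert (eps * (t0 - 0) <= eps * 1) by (apply Rmult_le_compat_l; lra).
lra.
Qed.

Lemma ae01_impl (P Q : R -> Prop) :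
  (forall t, 0 <= t <= 1 -> P t -> Q t) -> ae01 P -> ae01 Q.
Proof.
intros HPQ HP eps Heps; destruct (HP eps Heps) as (a & b & Hab & Hcov & Hsum).
exists a, b; repeat split; trivial. intros x [Hx HQ]; apply Hcov; auto.
Qed.

Lemma abs_le_sqrt_sum_sqr (a b : R) :
  Rabs a <= sqrt (a ^ 2 + b ^ 2) /\ Rabs b <= sqrt (a ^ 2 + b ^ 2).
Proof.
split; rewrite <- sqrt_Rsqr_abs; apply sqrt_le_1_alt; unfold Rsqr; nra.
Qed.

Lemma length_lower_bounds (p q : R * R) (l : R) :
  grushin_length_of_curve p q l ->
  0 <= l /\ Rabs (fst p - fst q) <= l /\
  Rabs (snd p - snd q) <= (Rabs (fst p) + l) * l.
Proof.
intros (x & y & a & b & (Hx & Hy & _ & _ & Hae) & Hp & Hq & Hl).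
subst p q; simpl.
set (h := fun t => sqrt (a t ^ 2 + b t ^ 2)) in *.
assert (Hh : forall t, 0 <= h t) by (intros t; apply sqrt_pos).
assert (Hl0 := integral01_nonneg h l Hh Hl).
(* Needed at all times: it bounds the factor [x t] in the derivative of [y]. *)
assert (Hxt : forall t, 0 <= t <= 1 -> Rabs (x t - x 0) <= l).
{ intros t Ht. rewrite <- (Rmult_1_l l). apply ac_increment_le with h; trivial; [lra|].
  revert Hae; apply ae01_impl; intros u _ [Hu _]; exists (a u); split; trivial.
  rewrite Rmult_1_l; apply abs_le_sqrt_sum_sqr. }
repeat split; trivial.
- rewrite Rabs_minus_sym; apply Hxt; lra.
- rewrite Rabs_minus_sym; apply ac_increment_le with h; trivial; [|idtac|lra].
  + assert (H := Rabs_pos (x 0)); lra.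
  + revert Hae; apply ae01_impl; intros t Ht [_ Hyt].
    exists (x t * b t); split; trivial. rewrite Rabs_mult.
    apply Rmult_le_compat; try apply Rabs_pos; [|apply abs_le_sqrt_sum_sqr].
    replace (x t) with (x 0 + (x t - x 0)) by ring.
    eapply Rle_trans; [apply Rabs_triang|]. specialize (Hxt t Ht). lra.
Qed.

(** * Horizontal curves of prescribed length *)

(** With the straddle lemma as gauge, the errors over the cells telescope to at most [eps / 2]. *)
Lemma integral01_derivative (S h : R -> R) :
  (forall t, derivable_pt_lim S t (h t)) -> integral01 h (S 1 - S 0).
Proof.
intros HS eps Heps.
assert (Heps2 : 0 < eps / 2) by lra.
destruct (choice _ (fun t => increment_of_derivative S t (h t) (eps / 2) (HS t) Heps2))
  as [delta Hdelta].
exists delta; split; [intros t; apply Hdelta|]; intros P HP.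
assert (Hgen : forall W s e, fine delta s e W ->
  Rabs (rsum h s W - (S e - S s)) <= eps / 2 * (e - s)).
{ induction W as [|[t r] W IH]; simpl; intros s e HW.
  - subst. replace (0 - (S e - S e)) with 0 by ring. rewrite Rabs_R0; lra.
  - destruct HW as (H1 & H2 & H3 & H4 & HW).
    specialize (IH r e HW). destruct (Hdelta t) as [_ Ht].
    specialize (Ht s r H2 H3 H4).
    replace (h t * (r - s) + rsum h r W - (S e - S s))
      with ((rsum h r W - (S e - S r)) - (S r - S s - h t * (r - s))) by ring.
    eapply Rle_trans; [apply Rabs_triang|]. rewrite Rabs_Ropp. lra. }
specialize (Hgen P 0 1 HP). lra.
Qed.

Lemma abs_cont01_C1 (f f' : R -> R) :
  (forall t, derivable_pt_lim f t (f' t)) -> continuity f' -> abs_cont01 f.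
Proof.
intros Hf Hc eps Heps.
destruct (continuity_ab_maj (fun t => Rabs (f' t)) 0 1) as [M [HM _]]; [lra| |].
{ intros c _; apply (continuity_pt_comp f' Rabs); [apply Hc | apply Rcontinuity_abs]. }
set (K := Rabs (f' M)) in *.
assert (HK : 0 <= K) by apply Rabs_pos.
assert (Hlip : forall a b, 0 <= a -> a <= b -> b <= 1 -> Rabs (f b - f a) <= K * (b - a)).
{ intros a b Ha Hab Hb.
  destruct (Req_dec a b) as [->|Hne]; [rewrite Rminus_diag, Rabs_R0; lra|].
  destruct (MVT_cor2 f f' a b) as [c [Heq Hcab]]; [lra|intros; apply Hf|].
  rewrite Heq, Rabs_mult, (Rabs_pos_eq (b - a)) by lra.
  apply Rmult_le_compat_r; [lra|]. apply HM; lra. }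
(* [K + 1] because the Lipschitz constant [K] may vanish. *)
exists (eps / (K + 1)); split; [apply Rdiv_lt_0_compat; lra|].
intros L HL Hlen.
assert (Hend : forall W s, ac_chain s W -> s <= 1).
{ induction W as [|[a b] W IH]; simpl; intros s HW; [trivial|].
  assert (b <= 1) by (apply IH; tauto). lra. }
assert (Hvar : forall W s, 0 <= s -> ac_chain s W ->
  0 <= chain_len W /\ chain_var f W <= K * chain_len W).
{ induction W as [|[a b] W IH]; simpl; intros s Hs HW; [lra|].
  destruct HW as (H1 & H2 & HW). assert (Hb := Hend W b HW).
  destruct (IH b) as [H3 H4]; [lra|trivial|].
  assert (H5 := Hlip a b ltac:(lra) H2 Hb). lra. }
destruct (Hvar L 0) as [H1 H2]; [lra|trivial|].
assert (H3 : (K + 1) * chain_len L < (K + 1) * (eps / (K + 1)))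
  by (apply Rmult_lt_compat_l; lra).
replace ((K + 1) * (eps / (K + 1))) with eps in H3 by (field; lra).
lra.
Qed.

(** The superlevel set within [0,1] need not be open; enlarging [0,1] by [eps / 2] on each side
    makes it open and adds points from two short intervals only. *)
Lemma meas01_continuity (f : R -> R) : continuity f -> meas01 f.
Proof.
intros Hf c eps Heps.
exists (fun t => (- (eps / 2) < t < 1 + eps / 2) /\ c < f t); split; [|split].
- intros t [Ht Hc].
  assert (Hcont := Hf t (f t - c) ltac:(lra)).
  destruct Hcont as [al [Hal Hcl]].
  assert (Hd : 0 < Rmin al (Rmin (t + eps / 2) (1 + eps / 2 - t)))
    by (repeat apply Rmin_glb_lt; lra).
  exists (mkposreal _ Hd); intros u Hu; unfold disc in Hu; simpl in Hu.
  assert (H1 := Rmin_l al (Rmin (t + eps / 2) (1 + eps / 2 - t))).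
  assert (H2 := Rmin_r al (Rmin (t + eps / 2) (1 + eps / 2 - t))).
  assert (H3 := Rmin_l (t + eps / 2) (1 + eps / 2 - t)).
  assert (H4 := Rmin_r (t + eps / 2) (1 + eps / 2 - t)).
  assert (Hu' : Rabs (u - t) < al) by lra.
  apply Rabs_def2 in Hu; split; [lra|].
  destruct (Req_dec u t) as [->|Hne]; trivial.
  specialize (Hcl u); simpl in Hcl; unfold Rdist in Hcl.
  assert (H5 : Rabs (f u - f t) < f t - c).
  { apply Hcl; split; trivial. split; [exact I | intros E; apply Hne; auto]. }
  apply Rabs_def2 in H5; lra.
- intros t Ht; lra.
(* All intervals after the first two are empty. *)
- exists (fun k => match k with O => - (eps / 2) | S O => 1 | _ => 0 end),
    (fun k => match k with O => 0 | S O => 1 + eps / 2 | _ => 0 end).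
  repeat split.
  + intros [|[|k]]; lra.
  + intros t [[Ht Hc] Hn].
    destruct (Rlt_le_dec t 0); [exists O; lra|].
    destruct (Rlt_le_dec 1 t); [exists 1%nat; lra|].
    exfalso; apply Hn; lra.
  + assert (Hgen : forall N, psum (S (S N)) (fun k =>
      match k with O => 0 | S O => 1 + eps / 2 | _ => 0 end -
      match k with O => - (eps / 2) | S O => 1 | _ => 0 end) = eps).
    { induction N as [|N IH]; [simpl; lra|].
      change (psum (S (S (S N)))) with (fun g => psum (S (S N)) g + g (S (S N))).
      cbv beta. rewrite IH; lra. }
    intros [|[|N]]; [simpl; lra..|]. rewrite Hgen; lra.
Qed.

(* Moving with a continuous speed, instead of a piecewise constant one, makes
   the curves C^1, so that no exceptional times occur. *)
Definition ramp (t : R) : R := Rmax 0 t.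

Lemma continuity_ramp : continuity ramp.
Proof.
intros t eps Heps; exists eps; split; trivial.
intros u [_ Hu]; simpl in *; unfold Rdist in *.
unfold ramp, Rmax; apply Rabs_def2 in Hu; apply Rabs_def1;
  repeat destruct Rle_dec; lra.
Qed.

(** The first-order remainder is at most the square of the increment, also across the kink at 0. *)
Lemma is_derive_ramp_sqr (t : R) : is_derive (fun u => ramp u ^ 2) t (2 * ramp t).
Proof.
apply is_derive_Reals; intros eps Heps.
exists (mkposreal eps Heps); simpl; intros h Hh Hlt.
assert (Hq : Rabs (ramp (t + h) ^ 2 - ramp t ^ 2 - 2 * ramp t * h) <= Rabs h * Rabs h).
{ rewrite <- Rabs_mult, (Rabs_pos_eq (h * h)) by nra.
  unfold ramp, Rmax; apply Rabs_le; repeat destruct Rle_dec; nra. }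
replace ((ramp (t + h) * (ramp (t + h) * 1) - ramp t * (ramp t * 1)) / h - 2 * ramp t)
  with ((ramp (t + h) ^ 2 - ramp t ^ 2 - 2 * ramp t * h) / h) by (simpl; field; trivial).
unfold Rdiv; rewrite Rabs_mult, Rabs_inv.
assert (Hpos := Rabs_pos_lt h Hh).
apply Rle_lt_trans with (Rabs h); trivial.
apply Rmult_le_reg_r with (Rabs h); trivial.
rewrite Rmult_assoc, Rinv_l by lra. lra.
Qed.

Definition ease_out (t : R) : R := 9 * ramp (1 / 3 - t) ^ 2.
Definition ease_out' (t : R) : R := - 18 * ramp (1 / 3 - t).
Definition ease_in (t : R) : R := 9 * ramp (t - 2 / 3) ^ 2.
Definition ease_in' (t : R) : R := 18 * ramp (t - 2 / 3).
(** A scaled second difference of the squared ramp: its derivative is a tent over [1/3,2/3] of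
    integral 1. *)
Definition ease_mid (t : R) : R :=
  18 * (ramp (t - 1 / 3) ^ 2 - 2 * ramp (t - 1 / 2) ^ 2 + ramp (t - 2 / 3) ^ 2).
Definition ease_mid' (t : R) : R :=
  36 * (ramp (t - 1 / 3) - 2 * ramp (t - 1 / 2) + ramp (t - 2 / 3)).

Lemma is_derive_ramp_sqr_shift (c t : R) :
  is_derive (fun u => ramp (u - c) ^ 2) t (2 * ramp (t - c)).
Proof.
evar_last.
- apply (is_derive_comp (fun u => ramp u ^ 2) (fun u => u - c)).
  + apply is_derive_ramp_sqr.
  + auto_derive; [trivial|reflexivity].
- unfold scal; simpl; unfold mult; simpl; ring.
Qed.

Lemma is_derive_ease_out (t : R) : is_derive ease_out t (ease_out' t).
Proof.
unfold ease_out, ease_out'; evar_last.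
- apply is_derive_scal, (is_derive_comp (fun u => ramp u ^ 2) (fun u => 1 / 3 - u)).
  + apply is_derive_ramp_sqr.
  + auto_derive; [trivial|reflexivity].
- unfold scal; simpl; unfold mult; simpl; ring.
Qed.

Lemma is_derive_ease_in (t : R) : is_derive ease_in t (ease_in' t).
Proof.
unfold ease_in, ease_in'; evar_last.
- apply is_derive_scal, is_derive_ramp_sqr_shift.
- ring.
Qed.

Lemma is_derive_ease_mid (t : R) : is_derive ease_mid t (ease_mid' t).
Proof.
unfold ease_mid, ease_mid'; evar_last.
- apply is_derive_scal, (is_derive_plus (fun u => ramp (u - 1 / 3) ^ 2 - 2 * ramp (u - 1 / 2) ^ 2)).
  + apply (is_derive_minus (fun u => ramp (u - 1 / 3) ^ 2)).
    * apply is_derive_ramp_sqr_shift.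
    * apply is_derive_scal, is_derive_ramp_sqr_shift.
  + apply is_derive_ramp_sqr_shift.
- unfold minus, plus, opp; simpl; ring.
Qed.

Lemma continuity_ramp_comp (f : R -> R) : continuity f -> continuity (fun t => ramp (f t)).
Proof. intros Hf; exact (continuity_comp f ramp Hf continuity_ramp). Qed.

Lemma continuity_ease_out' : continuity ease_out'.
Proof.
apply continuity_scal, continuity_ramp_comp. reg.
Qed.

Lemma continuity_ease_in' : continuity ease_in'.
Proof. apply continuity_scal, continuity_ramp_comp. reg. Qed.

Lemma continuity_ease_mid' : continuity ease_mid'.
Proof.
apply continuity_scal, (continuity_plus (fun t => ramp (t - 1 / 3) - 2 * ramp (t - 1 / 2))).
- apply (continuity_minus (fun t => ramp (t - 1 / 3))).
  + apply continuity_ramp_comp; reg.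
  + apply continuity_scal, continuity_ramp_comp; reg.
- apply continuity_ramp_comp; reg.
Qed.

(* The velocities are supported in [0,1/3], [2/3,1] and [1/3,2/3] respectively,
   so the speed is the sum of their absolute values. *)
Lemma ease_supports (t : R) :
  ease_out' t <= 0 /\ 0 <= ease_in' t /\ 0 <= ease_mid' t /\
  ease_out' t * ease_in' t = 0 /\ ease_out' t * ease_mid' t = 0 /\
  ease_in' t * ease_mid' t = 0 /\
  ease_out t * ease_mid' t = 0 /\ ease_in t * ease_mid' t = 0.
Proof.
unfold ease_out', ease_in', ease_mid', ease_out, ease_in, ramp, Rmax.
destruct (Rle_dec 0 (1 / 3 - t)), (Rle_dec 0 (t - 1 / 3)), (Rle_dec 0 (t - 1 / 2)),
  (Rle_dec 0 (t - 2 / 3)); try (exfalso; lra); repeat split; try lra.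
all: try (replace t with (1 / 3) by lra; lra).
all: nra.
Qed.

Lemma ease_values :
  ease_out 0 = 1 /\ ease_out 1 = 0 /\ ease_in 0 = 0 /\ ease_in 1 = 1 /\
  ease_mid 0 = 0 /\ ease_mid 1 = 1.
Proof.
unfold ease_out, ease_in, ease_mid, ramp, Rmax.
repeat destruct Rle_dec; try (exfalso; lra); repeat split; lra.
Qed.

Lemma derivable_pt_lim_lincomb (c a1 a2 t d1 d2 : R) (f1 f2 : R -> R) :
  is_derive f1 t d1 -> is_derive f2 t d2 ->
  derivable_pt_lim (fun u => c + a1 * f1 u + a2 * f2 u) t (a1 * d1 + a2 * d2).
Proof.
intros H1 H2; apply is_derive_Reals; evar_last.
- apply (is_derive_plus (fun u => c + a1 * f1 u)).
  + apply (is_derive_plus (fun _ => c)); [apply is_derive_const|].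
    apply is_derive_scal, H1.
  + apply is_derive_scal, H2.
- unfold plus, zero; simpl; ring.
Qed.

Lemma ae01_all (P : R -> Prop) : (forall t, P t) -> ae01 P.
Proof.
intros HP eps Heps; exists (fun _ => 0), (fun _ => 0); split; [|split].
- intros; lra.
- intros x [_ Hx]; exfalso; auto.
- induction N as [|N IH]; simpl; lra.
Qed.

(** Go to the abscissa [z], then vertically along it, then to [x1]. The length is computed from an
    explicit antiderivative [S] of the speed. *)
Lemma three_leg_curve (x0 y0 x1 z beta : R) :
  grushin_length_of_curve (x0, y0) (x1, y0 + z * beta)
    (Rabs (x0 - z) + Rabs beta + Rabs (x1 - z)).
Proof.
set (x := fun t => z + (x0 - z) * ease_out t + (x1 - z) * ease_in t).
set (y := fun t => y0 + z * beta * ease_mid t).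
set (a := fun t => (x0 - z) * ease_out' t + (x1 - z) * ease_in' t).
set (b := fun t => beta * ease_mid' t).
set (S := fun t => 0 + Rabs beta * ease_mid t + Rabs (x1 - z) * ease_in t
                   + - Rabs (x0 - z) * ease_out t).
set (s := fun t => Rabs beta * ease_mid' t + Rabs (x1 - z) * ease_in' t
                   - Rabs (x0 - z) * ease_out' t).
destruct ease_values as (E1 & E2 & E3 & E4 & E5 & E6).
assert (Ha : continuity a).
{ apply (continuity_plus (fun t => (x0 - z) * ease_out' t));
    apply continuity_scal; [apply continuity_ease_out' | apply continuity_ease_in']. }
assert (Hb : continuity b) by apply continuity_scal, continuity_ease_mid'.
assert (Hx : forall t, derivable_pt_lim x t (a t)).
{ intros t; apply derivable_pt_lim_lincomb; [apply is_derive_ease_out | apply is_derive_ease_in]. }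
assert (Hy : forall t, derivable_pt_lim y t (z * beta * ease_mid' t)).
{ intros t; apply is_derive_Reals; unfold y; evar_last.
  - apply (is_derive_plus (fun _ => y0)); [apply is_derive_const|].
    apply is_derive_scal, is_derive_ease_mid.
  - unfold plus, zero; simpl; ring. }
assert (HS : forall t, derivable_pt_lim S t (s t)).
{ intros t; apply is_derive_Reals; unfold S, s; evar_last.
  - apply (is_derive_plus (fun t => 0 + Rabs beta * ease_mid t + Rabs (x1 - z) * ease_in t)).
    + apply is_derive_Reals, derivable_pt_lim_lincomb; [apply is_derive_ease_mid | apply is_derive_ease_in].
    + apply is_derive_scal, is_derive_ease_out.
  - unfold plus; simpl; ring. }
exists x, y, a, b; repeat split.
- apply abs_cont01_C1 with a; trivial.
- apply abs_cont01_C1 with (fun t => z * beta * ease_mid' t); trivial.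
  apply continuity_scal, continuity_ease_mid'.
- now apply meas01_continuity.
- now apply meas01_continuity.
- apply ae01_all; intros t; split; [apply Hx|].
  destruct (ease_supports t) as (_ & _ & _ & _ & _ & _ & H1 & H2).
  (* Whenever the vertical velocity is nonzero, the abscissa is exactly [z]. *)
  replace (x t * b t) with (z * beta * ease_mid' t); [apply Hy|].
  unfold x, b.
  replace ((z + (x0 - z) * ease_out t + (x1 - z) * ease_in t) * (beta * ease_mid' t))
    with (z * beta * ease_mid' t + (x0 - z) * beta * (ease_out t * ease_mid' t)
          + (x1 - z) * beta * (ease_in t * ease_mid' t)) by ring.
  rewrite H1, H2; ring.
- unfold x, y; rewrite E1, E3, E5; f_equal; ring.
- unfold x, y; rewrite E2, E4, E6; f_equal; ring.
- replace (Rabs (x0 - z) + Rabs beta + Rabs (x1 - z)) with (S 1 - S 0)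
    by (unfold S; rewrite E1, E2, E3, E4, E5, E6; ring).
  replace (fun t => sqrt (a t ^ 2 + b t ^ 2)) with s.
  + now apply integral01_derivative.
  + apply functional_extensionality; intros t.
    destruct (ease_supports t) as (P1 & P2 & P3 & Z1 & Z2 & Z3 & _ & _).
    symmetry; apply sqrt_lem_1.
    * assert (H1 := pow2_ge_0 (a t)); assert (H2 := pow2_ge_0 (b t)); lra.
    * unfold s. assert (Q0 := Rabs_pos (x0 - z)); assert (Q1 := Rabs_pos (x1 - z));
      assert (Q2 := Rabs_pos beta).
      assert (0 <= Rabs beta * ease_mid' t) by (apply Rmult_le_pos; lra).
      assert (0 <= Rabs (x1 - z) * ease_in' t) by (apply Rmult_le_pos; lra).
      assert (0 <= Rabs (x0 - z) * - ease_out' t) by (apply Rmult_le_pos; lra).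
      lra.
    * assert (Hsq : forall r, Rabs r * Rabs r = r * r)
        by (intros r; rewrite <- Rabs_mult, Rabs_pos_eq; nra).
      unfold s, a, b.
      transitivity ((Rabs beta * Rabs beta) * ease_mid' t ^ 2
        + (Rabs (x1 - z) * Rabs (x1 - z)) * ease_in' t ^ 2
        + (Rabs (x0 - z) * Rabs (x0 - z)) * ease_out' t ^ 2
        + 2 * Rabs beta * Rabs (x1 - z) * (ease_in' t * ease_mid' t)
        - 2 * Rabs beta * Rabs (x0 - z) * (ease_out' t * ease_mid' t)
        - 2 * Rabs (x1 - z) * Rabs (x0 - z) * (ease_out' t * ease_in' t)); [ring|].
      rewrite !Hsq, Z1, Z2, Z3.
      transitivity ((x0 - z) ^ 2 * ease_out' t ^ 2 + (x1 - z) ^ 2 * ease_in' t ^ 2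
        + 2 * (x0 - z) * (x1 - z) * (ease_out' t * ease_in' t) + beta ^ 2 * ease_mid' t ^ 2);
        [rewrite Z1; ring | ring].
Qed.

(** * Variation of a single frequency *)

Definition bump (v : R) : R := / (1 + v ^ 2).

Lemma bump_bounds (v : R) : 0 < bump v <= 1 /\ Rabs v * bump v <= 1 / 2 /\ v ^ 2 * bump v <= 1.
Proof.
unfold bump.
assert (Hv : Rabs v * Rabs v = v ^ 2) by (rewrite <- Rabs_mult, Rabs_pos_eq; nra).
assert (H0 := pow2_ge_0 v).
assert (Hi : (1 + v ^ 2) * / (1 + v ^ 2) = 1) by (apply Rinv_r; lra).
assert (Hp : 0 < / (1 + v ^ 2)) by (apply Rinv_0_lt_compat; lra).
assert (H1 := pow2_ge_0 (Rabs v - 1)).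
repeat split; nra.
Qed.

(** From 1/(1+v^2) - 1/(1+w^2) = (w-v)(w+v) / ((1+v^2)(1+w^2)). The three lemmas that follow exploit
    it for small arguments, for all arguments, and for large [v]. *)
Lemma bump_diff (v w : R) :
  Rabs (bump v - bump w) <= Rabs (v - w) * ((Rabs v + Rabs w) * (bump v * bump w)).
Proof.
assert (Hv := bump_bounds v); assert (Hw := bump_bounds w).
replace (bump v - bump w) with ((v - w) * (- (v + w) * (bump v * bump w))).
- rewrite !Rabs_mult, Rabs_Ropp, (Rabs_pos_eq (bump v)), (Rabs_pos_eq (bump w)) by lra.
  apply Rmult_le_compat_l; [apply Rabs_pos|].
  apply Rmult_le_compat_r; [nra | apply Rabs_triang].
- unfold bump; field.
  split; [assert (H := pow2_ge_0 w) | assert (H := pow2_ge_0 v)]; lra.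
Qed.

Lemma bump_diff_le_sum (v w : R) :
  Rabs (bump v - bump w) <= Rabs (v - w) * (Rabs v + Rabs w).
Proof.
eapply Rle_trans; [apply bump_diff|].
apply Rmult_le_compat_l; [apply Rabs_pos|].
assert (Hv := bump_bounds v); assert (Hw := bump_bounds w).
rewrite <- (Rmult_1_r (Rabs v + Rabs w)) at 2.
apply Rmult_le_compat_l; [|nra].
assert (H1 := Rabs_pos v); assert (H2 := Rabs_pos w); lra.
Qed.

Lemma bump_lipschitz (v w : R) : Rabs (bump v - bump w) <= Rabs (v - w).
Proof.
eapply Rle_trans; [apply bump_diff|].
rewrite <- (Rmult_1_r (Rabs (v - w))) at 2.
apply Rmult_le_compat_l; [apply Rabs_pos|].
assert (Hv := bump_bounds v); assert (Hw := bump_bounds w).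
assert (H1 := Rabs_pos v); assert (H2 := Rabs_pos w).
assert (Rabs v * bump v * bump w <= 1 / 2) by nra.
assert (Rabs w * bump w * bump v <= 1 / 2) by nra.
lra.
Qed.

Lemma bump_diff_decay (v w : R) :
  Rabs v * Rabs (bump v - bump w) <= 2 * Rabs (v - w).
Proof.
apply Rle_trans with (Rabs v * (Rabs (v - w) * ((Rabs v + Rabs w) * (bump v * bump w)))).
{ apply Rmult_le_compat_l; [apply Rabs_pos | apply bump_diff]. }
assert (Hv := bump_bounds v); assert (Hw := bump_bounds w).
assert (H1 := Rabs_pos v); assert (H2 := Rabs_pos w).
assert (Hsq : Rabs v * Rabs v = v ^ 2) by (rewrite <- Rabs_mult, Rabs_pos_eq; nra).
replace (Rabs v * (Rabs (v - w) * ((Rabs v + Rabs w) * (bump v * bump w))))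
  with (((Rabs v * Rabs v * bump v) * bump w + (Rabs v * bump v) * (Rabs w * bump w))
        * Rabs (v - w)) by ring.
apply Rmult_le_compat_r; [apply Rabs_pos|]. rewrite Hsq.
assert (0 <= Rabs v * bump v) by nra. assert (0 <= Rabs w * bump w) by nra.
assert (0 <= v ^ 2 * bump v) by nra.
nra.
Qed.

(** This is [wave c 1], evaluated at the image of [p] under the Grushin dilation (x, y) -> (r x, r^2
    y), divided by [r]. *)
Definition wave (c : R -> R) (r : R) (p : R * R) : R :=
  bump (r * fst p) * c (r ^ 2 * snd p) / r.

(** Vanishing at 0 makes every wave vanish at the origin, which yields convergence of the series at
    low frequencies despite the factor 1/r. *)
Record oscillation (c : R -> R) : Prop := {
  osc_lipschitz : forall a b, Rabs (c a - c b) <= Rabs (a - b);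
  osc_bounded : forall a, Rabs (c a) <= 2;
  osc_zero : c 0 = 0 }.

Lemma wave_diff (c : R -> R) (r : R) (p q : R * R) :
  oscillation c -> 0 < r ->
  Rabs (wave c r p - wave c r q) <=
    bump (r * fst p) * (r * Rabs (snd p - snd q))
    + 2 * (Rabs (bump (r * fst p) - bump (r * fst q)) / r).
Proof.
intros [Hlip Hbd _] Hr; unfold wave.
set (v := r * fst p); set (w := r * fst q).
set (a := r ^ 2 * snd p); set (b := r ^ 2 * snd q).
assert (Hv := bump_bounds v).
replace (bump v * c a / r - bump w * c b / r)
  with (bump v * (c a - c b) / r + (bump v - bump w) * c b / r) by (field; lra).
assert (Hir : 0 < / r) by now apply Rinv_0_lt_compat.
eapply Rle_trans; [apply Rabs_triang|]. unfold Rdiv.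
rewrite !Rabs_mult, (Rabs_pos_eq (bump v)), (Rabs_pos_eq (/ r)) by lra.
apply Rplus_le_compat.
- rewrite Rmult_assoc; apply Rmult_le_compat_l; [lra|].
  replace (r * Rabs (snd p - snd q)) with (Rabs (a - b) * / r).
  + apply Rmult_le_compat_r; [lra | apply Hlip].
  + unfold a, b. rewrite <- Rmult_minus_distr_l, Rabs_mult, Rabs_pos_eq by (apply pow2_ge_0).
    field; lra.
- specialize (Hbd b). assert (H := Rabs_pos (bump v - bump w)).
  assert (Rabs (bump v - bump w) * Rabs (c b) <= Rabs (bump v - bump w) * 2)
    by (apply Rmult_le_compat_l; lra).
  nra.
Qed.

(* The scale [s] is the one at which [p] and [q] interact: the contribution of
   frequency [r] decays geometrically away from [r * s = 1] on both sides. *)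
Lemma wave_diff_le (c : R -> R) (r l s : R) (p q : R * R) :
  oscillation c -> 0 < r -> 0 <= l -> 0 < s -> s = Rmax (Rabs (fst p)) l ->
  Rabs (fst p - fst q) <= l ->
  Rabs (snd p - snd q) <= (Rabs (fst p) + l) * l ->
  Rabs (wave c r p - wave c r q) <= 8 * l * (r * s) /\
  Rabs (wave c r p - wave c r q) <= 8 * l * / (r * s).
Proof.
intros Hc Hr Hl Hs Hsdef HD HH.
assert (Hd := wave_diff c r p q Hc Hr).
set (W := Rabs (wave c r p - wave c r q)) in *.
assert (Hxs : Rabs (fst p) <= s) by (rewrite Hsdef; apply Rmax_l).
assert (Hls : l <= s) by (rewrite Hsdef; apply Rmax_r).
set (H := Rabs (snd p - snd q)) in *. assert (H0 : 0 <= H) by apply Rabs_pos.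
assert (HH2 : H <= 2 * s * l) by nra.
set (v := r * fst p) in *. set (w := r * fst q) in *.
assert (Hv := bump_bounds v).
assert (Habsv : Rabs v = r * Rabs (fst p)) by (unfold v; rewrite Rabs_mult, Rabs_pos_eq; lra).
assert (Hvw : Rabs (v - w) <= r * l).
{ unfold v, w. rewrite <- Rmult_minus_distr_l, Rabs_mult, (Rabs_pos_eq r) by lra.
  apply Rmult_le_compat_l; lra. }
assert (Hw : Rabs w <= Rabs v + r * l).
{ replace w with (v - (v - w)) by ring.
  eapply Rle_trans; [apply Rabs_triang|]. rewrite Rabs_Ropp; lra. }
assert (Hrs : 0 < r * s) by now apply Rmult_lt_0_compat.
assert (Hir : 0 < / r) by now apply Rinv_0_lt_compat.
split.
- assert (HB : Rabs (bump v - bump w) / r <= 3 * l * (r * s)).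
  { apply Rmult_le_reg_r with r; trivial. unfold Rdiv.
    rewrite Rmult_assoc, Rinv_l, Rmult_1_r by lra.
    eapply Rle_trans; [apply bump_diff_le_sum|].
    apply Rle_trans with ((r * l) * (3 * (r * s))); [|lra].
    apply Rmult_le_compat; trivial; [apply Rabs_pos| |].
    - assert (Q1 := Rabs_pos v); assert (Q2 := Rabs_pos w); lra.
    - rewrite Habsv in *. nra. }
  assert (bump v * (r * H) <= 2 * l * (r * s)); [|lra].
  assert (Hrh : 0 <= r * H) by (apply Rmult_le_pos; lra).
  assert (r * H <= r * (2 * s * l)) by (apply Rmult_le_compat_l; lra).
  nra.
(* If [s] is the abscissa, the decay of [bump] at [r * s] gives the bound. If [s] is [l], the bound
   is 8/r and follows from the size of the waves alone. *)
- destruct (Rle_lt_dec l (Rabs (fst p))) as [Hcase|Hcase].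
  + assert (Es : s = Rabs (fst p)) by (rewrite Hsdef; now apply Rmax_left).
    rewrite <- Es in Habsv.
    apply Rmult_le_reg_r with (r * s); trivial.
    rewrite (Rmult_assoc (8 * l)), Rinv_l, Rmult_1_r by lra.
    apply Rle_trans with ((bump v * (r * H) + 2 * (Rabs (bump v - bump w) / r)) * (r * s));
      [apply Rmult_le_compat_r; lra|].
    assert (Hdec := bump_diff_decay v w). rewrite Habsv in Hdec.
    assert (HB : Rabs (bump v - bump w) / r * (r * s) <= 2 * l).
    { apply Rmult_le_reg_r with r; trivial.
      replace (Rabs (bump v - bump w) / r * (r * s) * r)
        with (r * s * Rabs (bump v - bump w)) by (field; lra). lra. }
    assert (HA : bump v * (r * H) * (r * s) <= 2 * l).
    { apply Rle_trans with (bump v * (r * (2 * s * l)) * (r * s)).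
      - apply Rmult_le_compat_r; [lra|]. apply Rmult_le_compat_l; [lra|].
        apply Rmult_le_compat_l; lra.
      - assert (Hsq : v ^ 2 = (r * s) ^ 2) by (rewrite <- Habsv; symmetry; apply pow2_abs).
        replace (bump v * (r * (2 * s * l)) * (r * s))
          with (((r * s) ^ 2 * bump v) * (2 * l)) by ring.
        rewrite <- Hsq. nra. }
    lra.
  + assert (Es : s = l) by (rewrite Hsdef; apply Rmax_right; lra).
    replace (8 * l * / (r * s)) with (8 * / r) by (rewrite Es; field; lra).
    assert (Hbd : forall z, Rabs (wave c r z) <= 2 * / r).
    { intros z; unfold wave, Rdiv. rewrite !Rabs_mult, (Rabs_pos_eq (/ r)) by lra.
      apply Rmult_le_compat_r; [lra|].
      assert (Hz := bump_bounds (r * fst z)).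
      rewrite (Rabs_pos_eq (bump _)) by lra.
      assert (Q := osc_bounded c Hc (r ^ 2 * snd z)).
      assert (Q' := Rabs_pos (c (r ^ 2 * snd z))). nra. }
    assert (Hp := Hbd p); assert (Hq := Hbd q).
    unfold W. eapply Rle_trans; [apply Rabs_triang|]. rewrite Rabs_Ropp. lra.
Qed.

Lemma abs_diff_le_of_derivative (f f' : R -> R) (a b : R) :
  (forall t, derivable_pt_lim f t (f' t)) -> (forall t, Rabs (f' t) <= 1) ->
  Rabs (f a - f b) <= Rabs (a - b).
Proof.
intros Hf Hb.
destruct (MVT_abs f f' b a) as [c [-> _]]; [intros; apply Hf|].
specialize (Hb c). assert (H := Rabs_pos (a - b)). nra.
Qed.

Lemma oscillation_sin : oscillation sin.
Proof.
assert (Hc : forall t, Rabs (cos t) <= 1) by (intros t; apply Rabs_le, COS_bound).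
assert (Hs : forall t, Rabs (sin t) <= 1) by (intros t; apply Rabs_le, SIN_bound).
split.
- intros a b; apply abs_diff_le_of_derivative with cos; trivial.
  intros t; apply derivable_pt_lim_sin.
- intros a; specialize (Hs a); lra.
- apply sin_0.
Qed.

Lemma oscillation_cos : oscillation (fun t => cos t - 1).
Proof.
assert (Hs : forall t, Rabs (sin t) <= 1) by (intros t; apply Rabs_le, SIN_bound).
split.
- intros a b. replace (cos a - 1 - (cos b - 1)) with (cos a - cos b) by ring.
  apply abs_diff_le_of_derivative with (fun t => - sin t).
  + intros t; apply derivable_pt_lim_cos.
  + intros t; rewrite Rabs_Ropp; apply Hs.
- intros a; apply Rabs_le; assert (H := COS_bound a); lra.
- rewrite cos_0; ring.
Qed.

Lemma sin_ge_half (x : R) : 0 <= x <= 1 -> x / 2 <= sin x.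
Proof.
intros Hx; destruct (Req_dec x 0) as [->|Hne]; [rewrite sin_0; lra|].
destruct (MVT_cor2 sin cos 0 x) as [c [Heq Hc]]; [lra|intros; apply derivable_pt_lim_sin|].
rewrite sin_0 in Heq.
assert (Hpi := PI2_3_2). assert (Hpi4 := PI_4).
(* As 3 < pi, the point [c] lies below pi/3. *)
assert (1 / 2 <= cos c); [|nra].
rewrite <- cos_PI3; apply cos_decr_1; lra.
Qed.

(** With t = |a - b|, the chord between the points at angles [a] and [b] has length 2 sin(t/2) >=
    t/2, so its two coordinates cannot both be below t/4. *)
Lemma chord_lower (a b : R) :
  Rabs (a - b) <= 1 ->
  Rabs (a - b) / 4 <= Rabs (cos a - cos b) \/ Rabs (a - b) / 4 <= Rabs (sin a - sin b).
Proof.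
intros Hab.
set (t := Rabs (a - b)) in *. assert (Ht : 0 <= t) by apply Rabs_pos.
assert (Hs : t / 4 <= sin (t / 2)).
{ replace (t / 4) with (t / 2 / 2) by field. apply sin_ge_half; lra. }
assert (Hcos : cos t = cos (a - b)).
{ unfold t, Rabs; destruct Rcase_abs; trivial. apply cos_neg. }
assert (Hid : (cos a - cos b) ^ 2 + (sin a - sin b) ^ 2 = 4 * sin (t / 2) ^ 2).
{ assert (H1 := cos_2a_sin (t / 2)).
  replace (2 * (t / 2)) with t in H1 by field.
  rewrite Hcos, cos_minus in H1.
  assert (H2 := sin2_cos2 a); assert (H3 := sin2_cos2 b). unfold Rsqr in *. nra. }
destruct (Rle_lt_dec (t / 4) (Rabs (cos a - cos b))) as [|H1]; [now left|].
destruct (Rle_lt_dec (t / 4) (Rabs (sin a - sin b))) as [|H2]; [now right|].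
exfalso.
assert (Q1 := Rabs_pos (cos a - cos b)); assert (Q2 := Rabs_pos (sin a - sin b)).
rewrite <- (pow2_abs (cos a - cos b)), <- (pow2_abs (sin a - sin b)) in Hid.
nra.
Qed.

(** As [r * s] is at most 1/2, the phases differ by at most 1 and [bump] is at least 4/5 at [p]; as
    it is at least 1/4, the oscillation contributes at least l/1000. The change of [bump] costs at
    most l/5000, which leaves l/1250. *)
Lemma wave_lower (r l s : R) (p q : R * R) :
  0 < r -> 0 <= l -> l <= s -> Rabs (fst p) <= s -> 1 / 4 <= r * s <= 1 / 2 ->
  Rabs (fst p - fst q) <= l / 10000 ->
  s * l / 50 <= Rabs (snd p - snd q) <= 2 * s * l ->
  exists c, (c = (fun t => cos t - 1) \/ c = sin) /\
    l / 1250 <= Rabs (wave c r p - wave c r q).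
Proof.
intros Hr Hl Hls Hxs Hrs HD HH.
set (H := Rabs (snd p - snd q)) in *.
set (a := r ^ 2 * snd p); set (b := r ^ 2 * snd q).
set (v := r * fst p); set (w := r * fst q).
assert (Hab : Rabs (a - b) = r * (r * H)).
{ unfold a, b. rewrite <- Rmult_minus_distr_l, Rabs_mult, Rabs_pos_eq by (apply pow2_ge_0).
  unfold H; ring. }
assert (HrH : r * H <= r * (2 * s * l)) by (apply Rmult_le_compat_l; lra).
assert (HrH' : r * (s * l / 50) <= r * H) by (apply Rmult_le_compat_l; lra).
assert (Hrl : 0 <= r * l <= r * s) by (split; [apply Rmult_le_pos | apply Rmult_le_compat_l]; lra).
assert (Hsmall : Rabs (a - b) <= 1).
{ rewrite Hab. apply Rle_trans with (r * (r * (2 * s * l))); [apply Rmult_le_compat_l; lra|].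
  replace (r * (r * (2 * s * l))) with (2 * (r * s) * (r * l)) by ring. nra. }
assert (Hv : 4 / 5 <= bump v).
{ assert (Hv2 : v ^ 2 <= 1 / 4).
  { rewrite <- pow2_abs. assert (Q := Rabs_pos v).
    assert (Rabs v <= 1 / 2); [|nra].
    unfold v; rewrite Rabs_mult, (Rabs_pos_eq r) by lra.
    assert (r * Rabs (fst p) <= r * s) by (apply Rmult_le_compat_l; lra). lra. }
  unfold bump. replace (4 / 5) with (/ (5 / 4)) by field.
  apply Rinv_le_contravar; assert (Q := pow2_ge_0 v); lra. }
assert (Hgen : forall c, oscillation c -> Rabs (a - b) / 4 <= Rabs (c a - c b) ->
  l / 1250 <= Rabs (wave c r p - wave c r q)).
{ intros c Hc Hlow.
  assert (Hir : 0 < / r) by now apply Rinv_0_lt_compat.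
  assert (HV : l / 1000 <= Rabs (bump v * (c a - c b) / r)).
  { unfold Rdiv at 2. rewrite !Rabs_mult, (Rabs_pos_eq (bump v)), (Rabs_pos_eq (/ r)) by lra.
    apply Rmult_le_reg_r with r; trivial.
    rewrite (Rmult_assoc _ (/ r)), Rinv_l, Rmult_1_r by lra.
    assert (4 / 5 * (Rabs (a - b) / 4) <= bump v * Rabs (c a - c b)).
    { apply Rmult_le_compat; try lra. assert (Q := Rabs_pos (a - b)); lra. }
    rewrite Hab in *.
    assert (l / 200 <= r * H).
    { apply Rle_trans with (2 := HrH'). nra. }
    assert (l / 200 * r <= r * (r * H)) by nra. lra. }
  assert (HW : Rabs ((bump v - bump w) * c b / r) <= l / 5000).
  { unfold Rdiv at 1. rewrite !Rabs_mult, (Rabs_pos_eq (/ r)) by lra.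
    apply Rmult_le_reg_r with r; trivial.
    rewrite (Rmult_assoc _ (/ r)), Rinv_l, Rmult_1_r by lra.
    assert (Q := osc_bounded c Hc b). assert (Q' := bump_lipschitz v w).
    assert (Hvw : Rabs (v - w) <= r * (l / 10000)).
    { unfold v, w. rewrite <- Rmult_minus_distr_l, Rabs_mult, (Rabs_pos_eq r) by lra.
      apply Rmult_le_compat_l; lra. }
    apply Rle_trans with (r * (l / 10000) * 2); [|lra].
    apply Rmult_le_compat; try apply Rabs_pos; lra. }
  replace (wave c r p - wave c r q)
    with (bump v * (c a - c b) / r - - ((bump v - bump w) * c b / r))
    by (unfold wave; fold v w a b; field; lra).
  eapply Rle_trans; [|apply Rabs_triang_inv]. rewrite Rabs_Ropp. lra. }
destruct (chord_lower a b Hsmall) as [Hc|Hc].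
- exists (fun t => cos t - 1); split; [now left|].
  apply Hgen; [apply oscillation_cos|].
  replace (cos a - 1 - (cos b - 1)) with (cos a - cos b) by ring. exact Hc.
- exists sin; split; [now right|]. apply Hgen; [apply oscillation_sin | exact Hc].
Qed.

(** * Lacunary series *)

Definition two_sided (u : Z -> R) : R :=
  Series (fun n => u (Z.of_nat n)) + Series (fun n => u (-1 - Z.of_nat n)%Z).

(** The splitting index [j] is a parameter so that the sum can be estimated around its dominant
    term. *)
Definition is_two_sided (u : Z -> R) (j : Z) (v : R) : Prop :=
  exists A B : R, is_series (fun n => u (j + Z.of_nat n)%Z) A /\
    is_series (fun n => u (j - 1 - Z.of_nat n)%Z) B /\ v = A + B.

Lemma is_series_behead (a : nat -> R) (l : R) :
  is_series a l <-> is_series (fun n => a (S n)) (l - a O).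
Proof.
split; intros Ha.
- apply is_series_incr_1.
  change (is_series a (l - a O + a O)).
  now replace (l - a O + a O) with l by ring.
- apply is_series_decr_1. exact Ha.
Qed.

Lemma is_two_sided_succ (u : Z -> R) (j : Z) (v : R) :
  is_two_sided u j v <-> is_two_sided u (Z.succ j) v.
Proof.
split; intros (A & B & HA & HB & ->).
- exists (A - u j), (B + u j); repeat split; [| |ring].
  + apply is_series_behead in HA; rewrite Z.add_0_r in HA.
    revert HA; apply is_series_ext; intros n; f_equal; lia.
  + apply is_series_behead.
    replace (Z.succ j - 1 - Z.of_nat 0)%Z with j by (simpl; lia).
    replace (B + u j - u j) with B by ring.
    revert HB; apply is_series_ext; intros n; f_equal; lia.
- exists (A + u j), (B - u j); repeat split; [| |ring].
  + apply is_series_behead.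
    rewrite Z.add_0_r. replace (A + u j - u j) with A by ring.
    revert HA; apply is_series_ext; intros n; f_equal; lia.
  + apply is_series_behead in HB.
    replace (Z.succ j - 1 - Z.of_nat 0)%Z with j in HB by (simpl; lia).
    revert HB; apply is_series_ext; intros n; f_equal; lia.
Qed.

Lemma is_two_sided_shift (u : Z -> R) (j : Z) (v : R) :
  is_two_sided u j v -> is_two_sided u 0 v.
Proof.
pattern j; apply Z.bi_induction.
- intros x y ->; tauto.
- trivial.
- intros n; rewrite is_two_sided_succ; tauto.
Qed.

Lemma two_sided_unique (u : Z -> R) (v : R) : is_two_sided u 0 v -> two_sided u = v.
Proof.
intros (A & B & HA & HB & ->); unfold two_sided; f_equal; apply is_series_unique.
- exact HA.
- revert HB; apply is_series_ext; intros n; f_equal; lia.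
Qed.

Lemma is_two_sided_minus (u w : Z -> R) (a b : R) :
  is_two_sided u 0 a -> is_two_sided w 0 b -> is_two_sided (fun j => u j - w j) 0 (a - b).
Proof.
intros (A & B & HA & HB & ->) (A' & B' & HA' & HB' & ->).
exists (A - A'), (B - B'); repeat split; [| |ring].
- exact (is_series_minus _ _ _ _ HA HA').
- exact (is_series_minus _ _ _ _ HB HB').
Qed.

Lemma is_series_geom_bound (a : nat -> R) (M q : R) :
  0 <= q <= 1 / 2 -> 0 <= M -> (forall n, Rabs (a n) <= M * q ^ n) ->
  exists A : R, is_series a A /\ Rabs A <= 2 * M.
Proof.
intros Hq HM Ha.
assert (Hg : is_series (fun n => M * q ^ n) (M * / (1 - q))).
{ apply (is_series_scal M (fun n => q ^ n)), is_series_geom.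
  rewrite Rabs_pos_eq; lra. }
assert (Habs : ex_series (fun n => Rabs (a n))).
{ apply (ex_series_le (K := R_AbsRing) (V := R_CompleteNormedModule) _ (fun n => M * q ^ n)).
  - intros n. unfold norm; simpl; unfold abs; simpl. rewrite Rabs_Rabsolu. apply Ha.
  - now exists (M * / (1 - q)). }
exists (Series a); split; [apply Series_correct, ex_series_Rabs, Habs|].
apply Rle_trans with (Series (fun n => M * q ^ n)).
- eapply Rle_trans; [apply Series_Rabs, Habs|].
  apply Series_le; [|now exists (M * / (1 - q))].
  intros n; split; [apply Rabs_pos | apply Ha].
- rewrite (is_series_unique _ _ Hg), Rmult_comm. apply Rmult_le_compat_r; trivial.
  replace 2 with (/ (1 / 2)) by field. apply Rinv_le_contravar; lra.
Qed.

(** Once the term at [j0] is set aside, each half-series starts with a factor [q] and is at most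
    [2 * M * q]. *)
Lemma two_sided_geom_bound (u : Z -> R) (M q : R) (j0 : Z) :
  0 <= q <= 1 / 2 -> 0 <= M ->
  (forall j, Rabs (u j) <= M * q ^ (Z.abs_nat (j - j0))) ->
  exists v, is_two_sided u 0 v /\ Rabs v <= 4 * M /\ Rabs (v - u j0) <= 4 * M * q.
Proof.
intros Hq HM Hu.
assert (HMq : 0 <= M * q) by (apply Rmult_le_pos; lra).
destruct (is_series_geom_bound (fun n => u (Z.succ j0 + Z.of_nat n)%Z) (M * q) q Hq HMq)
  as (A & HA & HAb).
{ intros n; eapply Rle_trans; [apply Hu|].
  replace (Z.abs_nat (Z.succ j0 + Z.of_nat n - j0)) with (S n) by lia. simpl; lra. }
destruct (is_series_geom_bound (fun n => u (j0 - 1 - Z.of_nat n)%Z) (M * q) q Hq HMq)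
  as (B & HB & HBb).
{ intros n; eapply Rle_trans; [apply Hu|].
  replace (Z.abs_nat (j0 - 1 - Z.of_nat n - j0)) with (S n) by lia. simpl; lra. }
exists (A + (B + u j0)).
assert (Hdiff : Rabs (A + (B + u j0) - u j0) <= 4 * M * q).
{ replace (A + (B + u j0) - u j0) with (A + B) by ring.
  eapply Rle_trans; [apply Rabs_triang|]. lra. }
assert (H0 := Hu j0). rewrite Z.sub_diag in H0; simpl in H0.
split; [|split; trivial].
- apply is_two_sided_shift with (Z.succ j0).
  exists A, (B + u j0); repeat split; trivial.
  apply is_series_behead.
  replace (Z.succ j0 - 1 - Z.of_nat 0)%Z with j0 by (simpl; lia).
  replace (B + u j0 - u j0) with B by ring.
  revert HB; apply is_series_ext; intros n; f_equal; lia.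
- replace (A + (B + u j0)) with (A + B + u j0) by ring.
  eapply Rle_trans; [apply Rabs_triang|]. assert (Q := Rabs_triang A B).
  assert (M * q <= M * (1 / 2)) by (apply Rmult_le_compat_l; lra).
  lra.
Qed.

(** * Dyadic frequencies and the embedding *)

Lemma powerRZ_half (i : Z) :
  powerRZ 2 i = (/ 2) ^ Z.abs_nat i \/ / powerRZ 2 i = (/ 2) ^ Z.abs_nat i.
Proof.
destruct i as [|n|n]; simpl; [now left| |].
- right. now rewrite pow_inv.
- left. now rewrite pow_inv.
Qed.

Lemma powerRZ2_pos (k : Z) : 0 < powerRZ 2 k.
Proof. apply powerRZ_lt; lra. Qed.

Lemma dyadic_scale (s : R) : 0 < s -> exists k, 1 / 4 <= powerRZ 2 k * s <= 1 / 2.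
Proof.
intros Hs.
assert (Hln2 : 0 < ln 2) by (rewrite <- ln_1; apply ln_increasing; lra).
set (x := ln (1 / 2 / s) / ln 2).
destruct (archimed x) as [H1 H2].
(* The integer part of the base-2 logarithm of 1/(2s). *)
exists (up x - 1)%Z.
assert (Hx : Rpower 2 x * s = 1 / 2).
{ unfold Rpower, x. replace (ln (1 / 2 / s) / ln 2 * ln 2) with (ln (1 / 2 / s)) by (field; lra).
  rewrite exp_ln; [field; lra|]. apply Rdiv_lt_0_compat; lra. }
rewrite powerRZ_Rpower by lra. rewrite minus_IZR.
assert (Hm : forall a b, a <= b -> Rpower 2 a * s <= Rpower 2 b * s).
{ intros a b Hab; apply Rmult_le_compat_r; [lra|]. apply Rle_Rpower; lra. }
split.
- assert (Q := Hm (x - 1) (IZR (up x) - 1) ltac:(lra)).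
  unfold Rminus in Q at 1. rewrite Rpower_plus, Rpower_Ropp, Rpower_1 in Q by lra. lra.
- assert (Q := Hm (IZR (up x) - 1) x ltac:(lra)). lra.
Qed.

Definition channel (i : nat) : R -> R :=
  if (i <? 20)%nat then fun t => cos t - 1 else sin.

Lemma oscillation_channel (i : nat) : oscillation (channel i).
Proof.
unfold channel; destruct (i <? 20)%nat; [apply oscillation_cos | apply oscillation_sin].
Qed.

(* The frequencies are split into 20 classes modulo 20, once for each of the two
   oscillations, so that distinct frequencies within a coordinate differ by
   factors of at least 2^20 = 1048576. *)
Definition embed (p : R * R) (n : nat) : R :=
  match n with
  | O => fst p
  | S i => two_sided (fun j => wave (channel i) (powerRZ 2 (Z.of_nat i + 20 * j)) p)
  end.

(** The two bounds of [wave_diff_le] become one decay in the distance from [k] to the critical index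
    [k0]; 32 is 8 times the bound 4 for the inverse of [powerRZ 2 k0 * s]. *)
Lemma wave_diff_dyadic (c : R -> R) (l s : R) (p q : R * R) (k0 k : Z) :
  oscillation c -> 0 <= l -> 0 < s -> s = Rmax (Rabs (fst p)) l ->
  Rabs (fst p - fst q) <= l ->
  Rabs (snd p - snd q) <= (Rabs (fst p) + l) * l ->
  1 / 4 <= powerRZ 2 k0 * s <= 1 / 2 ->
  Rabs (wave c (powerRZ 2 k) p - wave c (powerRZ 2 k) q)
    <= 32 * l * (/ 2) ^ Z.abs_nat (k - k0).
Proof.
intros Hc Hl Hs Hsdef HD HH Hk0.
destruct (wave_diff_le c (powerRZ 2 k) l s p q Hc (powerRZ2_pos k) Hl Hs Hsdef HD HH)
  as [Hlow Hhigh].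
assert (Hk : powerRZ 2 k * s = powerRZ 2 (k - k0) * (powerRZ 2 k0 * s)).
{ rewrite <- Rmult_assoc, <- powerRZ_add by lra. do 2 f_equal; lia. }
set (u0 := powerRZ 2 k0 * s) in *. rewrite Hk in Hlow, Hhigh.
destruct (powerRZ_half (k - k0)) as [He|He].
- eapply Rle_trans; [apply Hlow|]. rewrite He.
  assert (Q : 0 < (/ 2) ^ Z.abs_nat (k - k0)) by (apply pow_lt; lra).
  assert (0 <= l * (/ 2) ^ Z.abs_nat (k - k0)) by (apply Rmult_le_pos; lra). nra.
- eapply Rle_trans; [apply Hhigh|]. rewrite Rinv_mult, He.
  assert (Q : 0 < (/ 2) ^ Z.abs_nat (k - k0)) by (apply pow_lt; lra).
  assert (0 <= l * (/ 2) ^ Z.abs_nat (k - k0)) by (apply Rmult_le_pos; lra).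
  assert (/ u0 <= 4); [|nra].
  replace 4 with (/ (1 / 4)) by field. apply Rinv_le_contravar; lra.
Qed.

(** The critical index [k0] need not lie in the class of [i]; replacing it by the nearest member
    below costs at most 2^20 = 1048576. *)
Lemma half_pow_class (i k0 j j0 : Z) :
  (0 <= k0 - (i + 20 * j0) < 20)%Z ->
  (/ 2) ^ Z.abs_nat (i + 20 * j - k0) <= 1048576 * (/ 1048576) ^ Z.abs_nat (j - j0).
Proof.
intros Hj0.
replace (/ 1048576) with ((/ 2) ^ 20) by field.
rewrite <- pow_mult.
assert (Hle : (20 * Z.abs_nat (j - j0) <= 20 + Z.abs_nat (i + 20 * j - k0))%nat) by lia.
apply Rmult_le_reg_l with ((/ 2) ^ 20); [apply pow_lt; lra|].
rewrite <- pow_add.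
apply Rle_trans with ((/ 2) ^ (20 * Z.abs_nat (j - j0))).
- rewrite !pow_inv. apply Rinv_le_contravar; [apply pow_lt; lra|].
  apply Rle_pow; [lra | exact Hle].
- apply Req_le. field.
Qed.

Lemma half_pow_same_class (i j j0 : Z) :
  (/ 2) ^ Z.abs_nat (i + 20 * j - (i + 20 * j0)) = (/ 1048576) ^ Z.abs_nat (j - j0).
Proof.
replace (/ 1048576) with ((/ 2) ^ 20) by field.
rewrite <- pow_mult. f_equal. lia.
Qed.

(** Compare [p] with the origin, where all waves vanish; this [l] satisfies both inequalities
    because it is at least 1 and exceeds both coordinates. *)
Lemma wave_series_converges (i : nat) (p : R * R) :
  is_two_sided (fun j => wave (channel i) (powerRZ 2 (Z.of_nat i + 20 * j)) p) 0 (embed p (S i)).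
Proof.
set (u := fun j => wave (channel i) (powerRZ 2 (Z.of_nat i + 20 * j)) p).
set (l := Rabs (fst p) + Rabs (snd p) + 1).
assert (H1 := Rabs_pos (fst p)); assert (H2 := Rabs_pos (snd p)).
assert (Hs : l = Rmax (Rabs (fst p)) l) by (rewrite Rmax_right; unfold l; lra).
destruct (dyadic_scale l) as [k0 Hk0]; [unfold l; lra|].
destruct (two_sided_geom_bound u (32 * l * 1048576) (/ 1048576)
  ((k0 - Z.of_nat i) / 20)) as (v & Hv & _).
- lra.
- unfold l; lra.
- intros j.
  assert (Hz : wave (channel i) (powerRZ 2 (Z.of_nat i + 20 * j)) (0, 0) = 0).
  { unfold wave; simpl fst; simpl snd. rewrite !Rmult_0_r, (osc_zero _ (oscillation_channel i)).
    unfold Rdiv; ring. }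
  replace (u j) with (u j - wave (channel i) (powerRZ 2 (Z.of_nat i + 20 * j)) (0, 0))
    by (rewrite Hz; ring).
  eapply Rle_trans.
  + apply (wave_diff_dyadic _ l l p (0, 0) k0); trivial; simpl;
      try rewrite Rminus_0_r; [apply oscillation_channel|unfold l..]; try lra. nra.
  + rewrite (Rmult_assoc (32 * l)). apply Rmult_le_compat_l; [unfold l; lra|].
    apply half_pow_class. assert (Q := Z.mod_pos_bound (k0 - Z.of_nat i) 20).
    assert (Q' := Z.div_mod (k0 - Z.of_nat i) 20). lia.
- change (embed p (S i)) with (two_sided u). now rewrite (two_sided_unique u v Hv).
Qed.

(** The constant is 4 * 32 * 2^20: the sum of a two-sided geometric bound with the loss of
    [half_pow_class]. *)
Lemma embed_diff_le (i : nat) (l : R) (p q : R * R) :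
  0 <= l -> 0 < Rmax (Rabs (fst p)) l ->
  Rabs (fst p - fst q) <= l ->
  Rabs (snd p - snd q) <= (Rabs (fst p) + l) * l ->
  Rabs (embed p i - embed q i) <= 134217728 * l.
Proof.
intros Hl Hs HD HH. destruct i as [|i]; [simpl; lra|].
destruct (dyadic_scale _ Hs) as [k0 Hk0].
destruct (two_sided_geom_bound
  (fun j => wave (channel i) (powerRZ 2 (Z.of_nat i + 20 * j)) p
          - wave (channel i) (powerRZ 2 (Z.of_nat i + 20 * j)) q)
  (32 * l * 1048576) (/ 1048576) ((k0 - Z.of_nat i) / 20)) as (v & Hv & Hvb & _).
- lra.
- lra.
- intros j; eapply Rle_trans.
  + apply (wave_diff_dyadic _ l (Rmax (Rabs (fst p)) l) p q k0); trivial; apply oscillation_channel.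
  + rewrite (Rmult_assoc (32 * l)). apply Rmult_le_compat_l; [lra|].
    apply half_pow_class. assert (Q := Z.mod_pos_bound (k0 - Z.of_nat i) 20).
    assert (Q' := Z.div_mod (k0 - Z.of_nat i) 20). lia.
- assert (E := two_sided_unique _ _ Hv).
  rewrite (two_sided_unique _ _ (is_two_sided_minus _ _ _ _
    (wave_series_converges i p) (wave_series_converges i q))) in E.
  rewrite E. lra.
Qed.

(** Here the critical index belongs to the class, so nothing is lost and the remaining terms sum to
    at most 4 * 32 * l / 2^20 = l/8192. This is why the modulus 20 is large enough. *)
Lemma embed_diff_main_term (i : nat) (l : R) (p q : R * R) (j0 : Z) :
  0 <= l -> 0 < Rmax (Rabs (fst p)) l ->
  Rabs (fst p - fst q) <= l ->
  Rabs (snd p - snd q) <= (Rabs (fst p) + l) * l ->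
  1 / 4 <= powerRZ 2 (Z.of_nat i + 20 * j0) * Rmax (Rabs (fst p)) l <= 1 / 2 ->
  Rabs (embed p (S i) - embed q (S i)
    - (wave (channel i) (powerRZ 2 (Z.of_nat i + 20 * j0)) p
       - wave (channel i) (powerRZ 2 (Z.of_nat i + 20 * j0)) q)) <= l / 5000.
Proof.
intros Hl Hs HD HH Hk0.
destruct (two_sided_geom_bound
  (fun j => wave (channel i) (powerRZ 2 (Z.of_nat i + 20 * j)) p
          - wave (channel i) (powerRZ 2 (Z.of_nat i + 20 * j)) q)
  (32 * l) (/ 1048576) j0) as (v & Hv & _ & Hvb).
- lra.
- lra.
- intros j; rewrite <- (half_pow_same_class (Z.of_nat i)).
  apply wave_diff_dyadic with (Rmax (Rabs (fst p)) l); trivial; apply oscillation_channel.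
- assert (E := two_sided_unique _ _ Hv).
  rewrite (two_sided_unique _ _ (is_two_sided_minus _ _ _ _
    (wave_series_converges i p) (wave_series_converges i q))) in E.
  rewrite E. eapply Rle_trans; [apply Hvb|]. lra.
Qed.

Lemma embed_separates (l : R) (p q : R * R) :
  0 <= l -> 0 < Rmax (Rabs (fst p)) l ->
  Rabs (fst p - fst q) <= l ->
  Rabs (snd p - snd q) <= (Rabs (fst p) + l) * l ->
  l / 10000 <= Rabs (fst p - fst q) \/
    Rmax (Rabs (fst p)) l * l / 50 <= Rabs (snd p - snd q) ->
  exists i, (i < 41)%nat /\ l / 10000 <= Rabs (embed p i - embed q i).
Proof.
intros Hl Hs HD HH Hcase.
destruct (Rle_lt_dec (l / 10000) (Rabs (fst p - fst q))) as [Hx|Hx].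
{ exists O; split; [lia | exact Hx]. }
destruct Hcase as [Hcase|Hcase]; [lra|].
set (s := Rmax (Rabs (fst p)) l) in *.
assert (Hxs : Rabs (fst p) <= s) by apply Rmax_l.
assert (Hls : l <= s) by apply Rmax_r.
destruct (dyadic_scale s Hs) as [k0 Hk0].
destruct (wave_lower (powerRZ 2 k0) l s p q) as (c & Hc & Hlow); trivial;
  [apply powerRZ2_pos | lra | nra |].
assert (Hfound : forall i j0, (i < 40)%nat -> k0 = (Z.of_nat i + 20 * j0)%Z ->
  channel i = c -> exists i', (i' < 41)%nat /\ l / 10000 <= Rabs (embed p i' - embed q i')).
{ intros i j0 Hi Hk Hch; exists (S i); split; [lia|].
  rewrite Hk in Hk0, Hlow.
  assert (Hmain := embed_diff_main_term i l p q j0 Hl Hs HD HH Hk0).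
  rewrite Hch in Hmain. rewrite Rabs_minus_sym in Hmain.
  set (W := wave c _ p - wave c _ q) in *.
  set (E := embed p (S i) - embed q (S i)) in *.
  assert (Htri : Rabs W <= Rabs E + Rabs (W - E)).
  { replace W with (E + (W - E)) at 1 by ring. apply Rabs_triang. }
  (* l/1250 - l/5000 exceeds l/10000. *)
  lra. }
assert (Q := Z.mod_pos_bound k0 20). assert (Q' := Z.div_mod k0 20).
destruct Hc as [Hc|Hc].
- apply (Hfound (Z.to_nat (k0 mod 20)) (k0 / 20)%Z); [lia|lia|].
  unfold channel. destruct (Nat.ltb_spec (Z.to_nat (k0 mod 20)) 20); [now rewrite Hc|lia].
(* Sine channels have numbers 20 to 39; the extra 20 is absorbed by lowering the series index by
   one. *)
- apply (Hfound (Z.to_nat (k0 mod 20 + 20)) (k0 / 20 - 1)%Z); [lia|lia|].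
  unfold channel. destruct (Nat.ltb_spec (Z.to_nat (k0 mod 20 + 20)) 20); [lia|now rewrite Hc].
Qed.

(** * Comparison of the two distances *)

Lemma eucl_dist_coord (n i : nat) (u v : nat -> R) :
  (i < n)%nat -> Rabs (u i - v i) <= eucl_dist n u v.
Proof.
intros Hi; unfold eucl_dist. rewrite <- sqrt_Rsqr_abs. apply sqrt_le_1_alt.
rewrite Rsqr_pow2. induction n as [|n IH]; [lia|]. cbn [psum].
assert (H0 : forall m, 0 <= psum m (fun k => (u k - v k) ^ 2)).
{ induction m as [|m IHm]; cbn [psum]; [lra|]. assert (Q := pow2_ge_0 (u m - v m)); lra. }
destruct (Nat.eq_dec i n) as [->|Hne].
- specialize (H0 n); lra.
- assert (Q := pow2_ge_0 (u n - v n)). assert (Q' := IH ltac:(lia)). lra.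
Qed.

Lemma eucl_dist_le (n : nat) (u v : nat -> R) (M : R) :
  0 <= M -> (forall i, Rabs (u i - v i) <= M) -> eucl_dist n u v <= INR n * M.
Proof.
intros HM Hb; unfold eucl_dist.
assert (Hn := pos_INR n).
rewrite <- (sqrt_pow2 (INR n * M)) by (apply Rmult_le_pos; lra).
apply sqrt_le_1_alt.
induction n as [|n IH]; [simpl; lra|]. cbn [psum]. rewrite S_INR.
specialize (IH (pos_INR n)). specialize (Hb n).
assert (Q : (u n - v n) ^ 2 <= M ^ 2).
{ rewrite <- pow2_abs. apply pow_incr; split; [apply Rabs_pos | exact Hb]. }
assert (Q' := pos_INR n).
replace (((INR n + 1) * M) ^ 2) with ((INR n * M) ^ 2 + 2 * (INR n * M ^ 2) + M ^ 2) by ring.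
assert (0 <= INR n * M ^ 2) by (apply Rmult_le_pos; [lra | apply pow2_ge_0]).
lra.
Qed.

Lemma efficient_curve (p q : R * R) :
  exists l, grushin_length_of_curve p q l /\
    (l / 10000 <= Rabs (fst p - fst q) \/
     Rmax (Rabs (fst p)) l * l / 50 <= Rabs (snd p - snd q)).
Proof.
destruct p as [x0 y0], q as [x1 y1]; simpl.
set (H := Rabs (y0 - y1)). assert (H0 : 0 <= H) by apply Rabs_pos.
set (D := Rabs (x0 - x1)). assert (D0 : 0 <= D) by apply Rabs_pos.
set (X := Rabs x0). assert (X0 : 0 <= X) by apply Rabs_pos.
assert (HX : X * X = x0 * x0) by (unfold X; rewrite <- Rabs_mult, Rabs_pos_eq; nra).
destruct (Rlt_le_dec (X * X) H) as [Hgt|Hle].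
(* At abscissa [h] the vertical leg has length H/h = h. *)
- set (h := sqrt H).
  assert (Hh : 0 < h) by (apply sqrt_lt_R0; nra).
  assert (Hhh : h * h = H) by now apply sqrt_sqrt.
  assert (HXh : X < h) by nra.
  assert (Hc := three_leg_curve x0 y0 x1 h ((y1 - y0) / h)).
  replace (y0 + h * ((y1 - y0) / h)) with y1 in Hc by (field; lra).
  unfold Rdiv in Hc; rewrite Rabs_mult, Rabs_inv, (Rabs_minus_sym y1), (Rabs_pos_eq h) in Hc by lra.
  fold H in Hc. replace (H * / h) with h in Hc by (rewrite <- Hhh; field; lra).
  set (l := Rabs (x0 - h) + h + Rabs (x1 - h)) in *.
  exists l; split; trivial.
  destruct (Rle_lt_dec (l / 10000) D) as [|HD]; [now left|right].
  assert (B1 : Rabs (x0 - h) <= X + h).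
  { eapply Rle_trans; [apply Rabs_triang|]. rewrite Rabs_Ropp, (Rabs_pos_eq h) by lra.
    apply Rle_refl. }
  assert (B2 : Rabs (x1 - h) <= D + Rabs (x0 - h)).
  { replace (x1 - h) with ((x1 - x0) + (x0 - h)) by ring.
    eapply Rle_trans; [apply Rabs_triang|]. rewrite (Rabs_minus_sym x1). apply Rle_refl. }
  assert (Hhl : h <= l).
  { assert (Q1 := Rabs_pos (x0 - h)); assert (Q2 := Rabs_pos (x1 - h)); unfold l; lra. }
  rewrite Rmax_right by lra.
  (* The legs add up to at most 5h + D, and D < l/10000. Hence l^2/50 <= 36 h^2/50 <= H. *)
  assert (l <= 6 * h) by (unfold l in *; lra).
  nra.
(* Here the vertical leg is at abscissa [x0]. If [x0] is 0, then [H] is 0 as well and a horizontal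
   segment suffices. *)
- destruct (Req_dec x0 0) as [Hx0|Hx0].
  { assert (EX : X = 0) by (unfold X; rewrite Hx0; apply Rabs_R0).
    assert (EH : H = 0) by nra.
    assert (Hy : y0 = y1).
    { apply Rminus_diag_uniq, NNPP; intros Hne. apply Rabs_pos_lt in Hne.
      unfold H in EH; lra. }
    assert (Hc := three_leg_curve x0 y0 x1 x0 0).
    rewrite Rmult_0_r, Rplus_0_r, Rminus_diag, Rabs_R0, (Rabs_minus_sym x1), Hy in Hc.
    fold D in Hc. exists (0 + 0 + D); split; [rewrite Hy; exact Hc|].
    left; lra. }
  assert (Xpos : 0 < X) by now apply Rabs_pos_lt.
  assert (Hc := three_leg_curve x0 y0 x1 x0 ((y1 - y0) / x0)).
  replace (y0 + x0 * ((y1 - y0) / x0)) with y1 in Hc by (field; trivial).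
  rewrite Rminus_diag, Rabs_R0, (Rabs_minus_sym x1) in Hc.
  unfold Rdiv in Hc; rewrite Rabs_mult, Rabs_inv, (Rabs_minus_sym y1) in Hc.
  fold D H X in Hc.
  set (l := 0 + H * / X + D) in *.
  exists l; split; trivial.
  destruct (Rle_lt_dec (l / 10000) D) as [|HD]; [now left|right].
  assert (HhX : H * / X * X = H) by (field; lra).
  set (h := H * / X) in *.
  (* As [D] is negligible, [l] is comparable to the vertical leg h = H/X <= X, so [Rmax X l * l] is
     comparable to h X = H. *)
  assert (Hhl : 9999 / 10000 * l <= h) by (unfold l in *; lra).
  assert (HhX' : h <= X) by nra.
  assert (Hl0 : 0 <= l) by (unfold l; nra).
  assert (Hmax : Rmax X l <= 2 * X) by (apply Rmax_lub; lra).
  nra.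
Qed.

Lemma glb_exists (E : R -> Prop) :
  (exists l, E l) -> (forall l, E l -> 0 <= l) -> exists m, is_glb E m.
Proof.
intros [l0 Hl0] Hpos.
destruct (completeness (fun m => E (- m))) as [m [Hub Hlub]].
- exists 0; intros x Hx; specialize (Hpos _ Hx); lra.
- exists (- l0); now rewrite Ropp_involutive.
- exists (- m); split.
  + intros l Hl. assert (- l <= m) by (apply Hub; now rewrite Ropp_involutive). lra.
  + intros m' Hm'. assert (m <= - m'); [|lra].
    apply Hlub; intros x Hx; specialize (Hm' _ Hx); lra.
Qed.

Theorem theorem4p7 :
  exists (n : nat) (F : R * R -> (nat -> R)) (L : R),
    0 < L /\
    forall p q : R * R, exists d : R,
      is_dcc p q d /\
      d <= L * eucl_dist n (F p) (F q) /\
      eucl_dist n (F p) (F q) <= L * d.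
Proof.
exists 41%nat, embed, (INR 41 * 134217728).
assert (HINR : INR 41 = 41) by (simpl; ring).
split; [lra|]. intros p q.
destruct (efficient_curve p q) as (l & Hcurve & Hcase).
destruct (glb_exists (grushin_length_of_curve p q)) as [d [Hlb Hglb]].
{ now exists l. }
{ intros l' Hl'; apply (length_lower_bounds p q l' Hl'). }
exists d; split; [now split|].
assert (Hdl := Hlb l Hcurve).
split.
- destruct (length_lower_bounds p q l Hcurve) as (Hl & HD & HH).
  assert (He : 0 <= eucl_dist 41 (embed p) (embed q)) by apply sqrt_pos.
  destruct (Req_dec l 0) as [->|Hne].
  { assert (0 <= INR 41 * 134217728 * eucl_dist 41 (embed p) (embed q))
      by (apply Rmult_le_pos; lra). lra. }
  assert (Hs : 0 < Rmax (Rabs (fst p)) l) by (apply Rlt_le_trans with l; [lra | apply Rmax_r]).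
  destruct (embed_separates l p q Hl Hs HD HH Hcase) as (i & Hi & Hlow).
  assert (Hco := eucl_dist_coord 41 i (embed p) (embed q) Hi).
  rewrite HINR; lra.
(* The estimate holds for the length of every curve, hence for the infimum. *)
- assert (Hdist : eucl_dist 41 (embed p) (embed q) / (INR 41 * 134217728) <= d).
  { apply Hglb; intros l' Hl'.
    destruct (length_lower_bounds p q l' Hl') as (Hl & HD & HH).
    apply Rmult_le_reg_r with (INR 41 * 134217728); [lra|].
    unfold Rdiv; rewrite Rmult_assoc, Rinv_l, Rmult_1_r by lra.
    rewrite (Rmult_comm l'), Rmult_assoc. apply eucl_dist_le; [lra|].
    intros i. destruct (Rlt_le_dec 0 (Rmax (Rabs (fst p)) l')) as [Hs|Hs].
    - now apply embed_diff_le.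
    (* There is no positive scale only if [l'] is 0, and then the points coincide. *)
    - assert (Hl0 : l' = 0) by (assert (Q := Rmax_r (Rabs (fst p)) l'); lra).
      assert (Hpq : p = q).
      { rewrite Hl0 in HD, HH. rewrite Rmult_0_r in HH. destruct p, q; simpl in *.
        f_equal; apply Rminus_diag_uniq, NNPP; intros Hne; apply Rabs_pos_lt in Hne; lra. }
      rewrite Hpq, Rminus_diag, Rabs_R0, Hl0; lra. }
  apply Rmult_le_compat_r with (r := INR 41 * 134217728) in Hdist; [|lra].
  unfold Rdiv in Hdist; rewrite Rmult_assoc, Rinv_l, Rmult_1_r in Hdist by lra.
  lra.
Qed.
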